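(* Assume that $F:\mathbb{R}^d\to\mathbb{R}$ is $M$-smooth. For $h>0$ and $s\in\mathbb{N}$ let $$g^{\mathrm S}_{h,s}(x)=\frac1s\sum_{i=1}^s\frac dh\big(F(x+hu_i)-F(x)\big)u_i,\qquad u_1,\dots,u_s\sim\mathrm{Unif}(\mathbb{S}^{d-1})\ \text{independent},$$ and assume $h\le1$. Then, for every $x\in\mathbb{R}^d$, $$\mathbb{E}\left[\big\|g^{\mathrm S}_{h,s}(x)-\nabla F(x)\big\|^2\right]\le\delta_{\mathrm S}\left(P_{\mathrm S}\|x\|^2+Q_{\mathrm S}\right),$$ where $$\delta_{\mathrm S}:=\frac{d^2}{s}+h^2,$$ and $P_{\mathrm S},Q_{\mathrm S}$ are constants independent of $d,\beta,\gamma,h,s$. In particular, the controlled-growth condition on the gradient error holds for $g^{\mathrm S}_{h,s}$ with $\delta=\delta_{\mathrm S}$, $P=P_{\mathrm S}$ and $Q=Q_{\mathrm S}$.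
   Context: $M$-smooth: $F$ is continuously differentiable and $\|\nabla F(x)-\nabla F(y)\|\le M\|x-y\|$ for all $x,y\in\mathbb{R}^d$. Standing assumption where the lemma appears: $F$ is also $(m,b)$-dissipative, i.e. $\langle x,\nabla F(x)\rangle\ge m\|x\|^2-b$ for all $x\in\mathbb{R}^d$, with constants $m,b>0$. $\mathrm{Unif}(\mathbb{S}^{d-1})$ is the uniform distribution on the Euclidean unit sphere of $\mathbb{R}^d$. Controlled-growth condition for a random surrogate $g(x,\xi)$ of $\nabla F(x)$: there exist non-negative constants $P,Q$ and a precision parameter $\delta>0$ such that $\mathbb{E}\big[\|g(x,\xi)-\nabla F(x)\|^2\big]\le\delta(P\|x\|^2+Q)$ for all $x\in\mathbb{R}^d$; $g$ is not required to be unbiased. $\beta>0$ and $\gamma>0$ are the inverse temperature and the stepsize of the zeroth-order Langevin algorithm $x_{k+1}=x_k-\gamma g^{\mathrm S}_{h,s}(x_k)+\sqrt{2\gamma\beta^{-1}}z_k$, $z_k\sim\mathcal N(0,I_d)$, in which the estimator is used; they do not enter the estimator. *)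

(* Defs.v *)
From HB Require Import structures.
From mathcomp Require Import all_boot all_order all_algebra.
From mathcomp Require Import all_classical all_reals all_analysis.
Import Order.TTheory GRing.Theory Num.Theory.
Import numFieldNormedType.Exports.

Set Implicit Arguments.
Unset Strict Implicit.
Unset Printing Implicit Defensive.

Local Open Scope classical_set_scope.
Local Open Scope ring_scope.

(** R^d is ['rV[R]_d]. Its library norm [`|x|] is the sup norm: it is used only
    through the topology and [differentiable], for which all norms agree. *)
Definition edot (R : realType) (d : nat) (x y : 'rV[R]_d) : R :=
  \sum_(j < d) x 0 j * y 0 j.

Definition enorm (R : realType) (d : nat) (x : 'rV[R]_d) : R :=
  Num.sqrt (edot x x).

(** Partial derivatives. This is the gradient only where F is differentiable. *)
Definition grad (R : realType) (d : nat) (F : 'rV[R]_d -> R) (x : 'rV[R]_d) :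
    'rV[R]_d :=
  \row_(j < d) 'D_(delta_mx 0 j) F x.

Definition smooth (R : realType) (d : nat) (M : R) (F : 'rV[R]_d -> R) : Prop :=
  [/\ forall x, differentiable F x,
      continuous (grad F)
    & forall x y, enorm (grad F x - grad F y) <= M * enorm (x - y)].

Definition dissipative (R : realType) (d : nat) (m b : R)
    (F : 'rV[R]_d -> R) : Prop :=
  forall x, m * enorm x ^+ 2 - b <= edot x (grad F x).

(** R^d with its Borel sigma-algebra, the library having no measurable
    structure on matrices. *)
Definition borel_rV (R : realType) (d : nat) :=
  g_sigma_algebraType (@open 'rV[R]_d).

Definition unit_sphere (R : realType) (d : nat) : set (borel_rV R d) :=
  [set x | enorm (x : 'rV[R]_d) = 1].

(** The uniform distribution on the unit sphere is the unique Borel probability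
    measure carried by the sphere and invariant under the orthogonal group.
    Invariance is under O(d) rather than SO(d): for d = 1, SO(d) is trivial. *)
Definition uniform_sphere (R : realType) (d : nat)
    (mu : probability (borel_rV R d) R) : Prop :=
  mu (@unit_sphere R d) = 1%E /\
  forall U : 'M[R]_d, U *m U^T = 1%:M ->
  forall A : set (borel_rV R d), measurable A ->
    mu [set x | A ((x : 'rV[R]_d) *m U)] = mu A.

Definition mutually_independent (dT dE : measure_display)
    (T : measurableType dT) (E : measurableType dE) (R : realType)
    (P : probability T R) (s : nat) (u : 'I_s -> {RV P >-> E}) : Prop :=
  forall (J : {set 'I_s}) (B : 'I_s -> set E),
    (forall i, measurable (B i)) ->
    P (\bigcap_(i in [set i | i \in J]) (u i @^-1` B i)) =
    (\prod_(i in J) P (u i @^-1` B i))%E.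

Definition sphere_estimator (R : realType) (d s : nat) (F : 'rV[R]_d -> R)
    (h : R) (u : 'I_s -> 'rV[R]_d) (x : 'rV[R]_d) : 'rV[R]_d :=
  s%:R^-1 *: \sum_(i < s) (d%:R / h * (F (x + h *: u i) - F x)) *: u i.

(** The surrogate is [g x w], the sample point w carrying the randomness. *)
Definition controlled_growth (dT : measure_display) (T : measurableType dT)
    (R : realType) (P : probability T R) (d : nat) (F : 'rV[R]_d -> R)
    (g : 'rV[R]_d -> T -> 'rV[R]_d) (delta Pc Qc : R) : Prop :=
  [/\ 0 <= Pc, 0 <= Qc, 0 < delta
    & forall x : 'rV[R]_d,
        ('E_P[(fun w => (enorm (g x w - grad F x) ^+ 2)%R)]
           <= (delta * (Pc * enorm x ^+ 2 + Qc))%:E)%E].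

(* Main.v *)
(** The squared error of an average of [s] independent samples is at most
    [C^2 / s + B^2], where [C] bounds one sample error on the sphere and [B]
    bounds its mean. Smoothness gives [C = d (2 |grad F x| + M h)]. The bias
    bound [B = M h], free of [d], needs no divergence theorem: pairing the mean
    with a vector [v] and symmetrizing under the reflection [y |-> y'] across
    the hyperplane orthogonal to [v] replaces [F (x + h y)] by the difference
    [F (x + h y) - F (x + h y')], where [y - y'] has length [2 |<y, v>| / |v|],
    and reflections also give [E <y, v>^2 = |v|^2 / d]. Dissipativity along
    [- grad F 0] bounds [|grad F 0|] by [b + M], which makes the constants
    independent of [F] and [d]. *)
Require Import Defs.
From HB Require Import structures.
From mathcomp Require Import all_boot all_order all_algebra.
From mathcomp Require Import all_classical all_reals all_analysis.
From mathcomp Require Import measurable_realfun ring lra.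
Import Order.TTheory GRing.Theory Num.Theory.
Import numFieldNormedType.Exports.

Set Implicit Arguments.
Unset Strict Implicit.
Unset Printing Implicit Defensive.

Local Open Scope classical_set_scope.
Local Open Scope ring_scope.

(** * Euclidean inner product, norm and reflections on row vectors *)

Section Euclidean.
Context {R : realType} {d : nat}.
Implicit Types (x y z v w : 'rV[R]_d) (a : R).

Lemma edotC x y : edot x y = edot y x.
Proof. by apply: eq_bigr => j _; rewrite mulrC. Qed.

Lemma edotDl x y z : edot (x + y) z = edot x z + edot y z.
Proof. by rewrite -big_split; apply: eq_bigr => j _; rewrite mxE mulrDl. Qed.

Lemma edotZl a x y : edot (a *: x) y = a * edot x y.
Proof.
by rewrite /edot big_distrr /=; apply: eq_bigr => j _; rewrite mxE mulrA.
Qed.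

Lemma edotNl x y : edot (- x) y = - edot x y.
Proof. by rewrite -scaleN1r edotZl mulN1r. Qed.

Lemma edotBl x y z : edot (x - y) z = edot x z - edot y z.
Proof. by rewrite edotDl edotNl. Qed.

Lemma edotDr x y z : edot x (y + z) = edot x y + edot x z.
Proof. by rewrite !(edotC x) edotDl. Qed.

Lemma edotZr a x y : edot x (a *: y) = a * edot x y.
Proof. by rewrite !(edotC x) edotZl. Qed.

Lemma edotBr x y z : edot x (y - z) = edot x y - edot x z.
Proof. by rewrite !(edotC x) edotBl. Qed.

Lemma edot0l x : edot 0 x = 0.
Proof. by rewrite -(scale0r 0) edotZl mul0r. Qed.

Lemma edot_suml I (r : seq I) (P : pred I) (f : I -> 'rV[R]_d) x :
  edot (\sum_(i <- r | P i) f i) x = \sum_(i <- r | P i) edot (f i) x.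
Proof.
by elim/big_rec2 : _ => [|i a y _ <-]; rewrite ?edot0l ?edotDl.
Qed.

Lemma edot_sumr I (r : seq I) (P : pred I) (f : I -> 'rV[R]_d) x :
  edot x (\sum_(i <- r | P i) f i) = \sum_(i <- r | P i) edot x (f i).
Proof. by rewrite edotC edot_suml; under eq_bigr do rewrite edotC. Qed.

Lemma edot_ge0 x : 0 <= edot x x.
Proof. by apply: sumr_ge0 => j _; rewrite -expr2 sqr_ge0. Qed.

Lemma edot_eq0 x : (edot x x == 0) = (x == 0).
Proof.
apply/eqP/eqP => [xx0|->]; last exact: edot0l.
apply/rowP => j; rewrite mxE; apply/eqP; rewrite -sqrf_eq0 expr2; apply/eqP.
exact: (psumr_eq0P (fun i _ => sqr_ge0 (x 0 i)) xx0).
Qed.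

Lemma enorm_ge0 x : 0 <= enorm x.
Proof. exact: sqrtr_ge0. Qed.

Lemma enorm_sqr x : enorm x ^+ 2 = edot x x.
Proof. by rewrite sqr_sqrtr// edot_ge0. Qed.

Lemma enorm_eq0 x : (enorm x == 0) = (x == 0).
Proof. by rewrite -edot_eq0 -enorm_sqr sqrf_eq0. Qed.

Lemma enorm0 : enorm (0 : 'rV[R]_d) = 0.
Proof. by apply/eqP; rewrite enorm_eq0. Qed.

Lemma enormZ a x : enorm (a *: x) = `|a| * enorm x.
Proof.
by rewrite /enorm edotZl edotZr mulrA -expr2 sqrtrM ?sqr_ge0// sqrtr_sqr.
Qed.

Lemma enormN x : enorm (- x) = enorm x.
Proof. by rewrite -scaleN1r enormZ normrN1 mul1r. Qed.

(** Cauchy-Schwarz: the squared length of [edot x x *: y - edot x y *: x] is [edot x x] times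
    [edot x x * edot y y - edot x y ^+ 2], and [edot x x] is positive once [x != 0]. *)
Lemma edot_le_enorm x y : `|edot x y| <= enorm x * enorm y.
Proof.
have [->|x0] := eqVneq x 0; first by rewrite edot0l normr0 enorm0 mul0r.
rewrite -ler_sqr ?nnegrE ?mulr_ge0 ?enorm_ge0// exprMn real_normK ?num_real//.
rewrite !enorm_sqr.
have xx0 : 0 < edot x x by rewrite lt_neqAle eq_sym edot_eq0 x0 edot_ge0.
have := edot_ge0 (edot x x *: y - edot x y *: x).
rewrite !(edotBl, edotBr, edotZl, edotZr) (edotC y x) => h.
rewrite -subr_ge0 -(pmulr_rge0 _ xx0); apply: le_trans h _.
by rewrite le_eqVlt; apply/orP; left; apply/eqP; ring.
Qed.

Lemma enormD x y : enorm (x + y) <= enorm x + enorm y.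
Proof.
rewrite -ler_sqr ?nnegrE ?addr_ge0 ?enorm_ge0//.
rewrite sqrrD !enorm_sqr edotDl !edotDr (edotC y x).
have := le_trans (ler_norm _) (edot_le_enorm x y); lra.
Qed.

Lemma enormB x y : enorm (x - y) <= enorm x + enorm y.
Proof. by rewrite (le_trans (enormD _ _))// enormN. Qed.

Lemma edotrE x y : x *m y^T = (edot x y)%:M.
Proof.
apply/matrixP => i j; rewrite !mxE !ord1 eqxx mulr1n.
by apply: eq_bigr => k _; rewrite !mxE.
Qed.

Lemma edot_mulmx (A : 'M[R]_d) x y : edot (x *m A) y = edot x (y *m A^T).
Proof.
have := edotrE (x *m A) y; rewrite -mulmxA -[A *m y^T]trmxK trmx_mul trmxK.
by rewrite edotrE => /matrixP/(_ 0 0); rewrite !mxE !mulr1n.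
Qed.

Lemma edot_delta x k : edot x (delta_mx 0 k) = x 0 k.
Proof.
rewrite /edot (bigD1 k)//= big1 => [|j jk];
  rewrite mxE ?(negbTE jk) ?andbF ?mulr0//.
by rewrite !eqxx mulr1 addr0.
Qed.

(** Division by zero makes this the identity when [w = 0]. *)
Definition householder w : 'M[R]_d := 1%:M - (2 / edot w w) *: (w^T *m w).

Lemma householder_tr w : (householder w)^T = householder w.
Proof.
by rewrite /householder linearB linearZ /= trmx1 trmx_mul trmxK.
Qed.

Lemma mul_householder x w :
  x *m householder w = x - (2 * edot x w / edot w w) *: w.
Proof.
rewrite mulmxBr mulmx1 -scalemxAr mulmxA edotrE mul_scalar_mx scalerA.
by congr (_ - _ *: _); ring.
Qed.

Lemma householder_orthogonal w : householder w *m (householder w)^T = 1%:M.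
Proof.
rewrite householder_tr; apply/row_matrixP => i.
rewrite !rowE mulmxA mulmx1 !mul_householder.
move: (delta_mx _ _) => x; have [->|w0] := eqVneq w 0.
  by rewrite !scaler0 !subr0.
have ww0 : edot w w != 0 by rewrite edot_eq0.
rewrite edotBl edotZl -addrA -opprD -scalerDl.
(* The second reflection undoes the displacement along [w] made by the first, so the total
   coefficient vanishes. *)
set c := (X in X *: w); have -> : c = 0 by rewrite /c; field.
by rewrite scale0r subr0.
Qed.

Lemma edot_orthogonal (U : 'M[R]_d) x y :
  U *m U^T = 1%:M -> edot (x *m U) (y *m U) = edot x y.
Proof. by move=> UU; rewrite edot_mulmx -mulmxA UU mulmx1. Qed.

(** Equal lengths give [2 * edot y (x - y) = - edot (x - y) (x - y)], so the reflection displaces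
    [y] by exactly [x - y]. *)
Lemma householder_swap x y :
  edot x x = edot y y -> y *m householder (x - y) = x.
Proof.
move=> xy; have [/eqP|ne] := eqVneq (x - y) 0.
  by rewrite subr_eq0 => /eqP ->; rewrite mul_householder subrr scaler0 subr0.
have /eqP := ne; move/eqP; rewrite -edot_eq0 => w0.
rewrite mul_householder.
have -> : 2 * edot y (x - y) / edot (x - y) (x - y) = -1.
  have /(canLR (mulfK w0)) <-// : 2 * edot y (x - y) = -1 * edot (x - y) (x - y).
  by rewrite !(edotBl, edotBr) (edotC y x) xy; ring.
by rewrite scaleN1r opprK addrC subrK.
Qed.

End Euclidean.

(** * Gradients and the mean value theorem *)

Section Calculus.
Context {R : realType} {d : nat}.
Implicit Types (x y z v w : 'rV[R]_d) (a : R) (F : 'rV[R]_d -> R).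

(** The differential is linear, so expanding [v] in the standard basis reduces its value to partial
    derivatives. *)
Lemma derive_grad F x v : differentiable F x -> 'D_v F x = edot (grad F x) v.
Proof.
move=> dF; rewrite deriveE// [in LHS](row_sum_delta v) linear_sum.
by apply: eq_bigr => j _; rewrite linearZ /= !mxE deriveE// mulrC.
Qed.

Lemma differentiable_MVT F x y : (forall z, differentiable F z) ->
  exists2 c : R, c \in `[0, 1] &
    F y - F x = edot (grad F (x + c *: (y - x))) (y - x).
Proof.
move=> dF; pose f (t : R) := F (x + t *: (y - x)).
have df (t : R) : is_derive t 1 f (edot (grad F (x + t *: (y - x))) (y - x)).
  (* The difference quotient of [f] at [t] is the quotient of [F] in direction [y - x] at the
     corresponding point, so derivability and derivative carry over to [f]. *)
  have quot : (fun s : R => s^-1 *: (f (s *: 1 + t) - f t)) =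
      (fun s : R => s^-1 *: (F (s *: (y - x) + (x + t *: (y - x))) - f t)).
    apply/funext => s; congr (_ *: (F _ - _)).
    by rewrite [s *: 1]mulr1 scalerDl addrCA.
  have dv := diff_derivable (v := y - x) (dF (x + t *: (y - x))).
  apply: DeriveDef; first by rewrite /derivable quot.
  by rewrite /derive quot -derive_grad.
have [|c c01] := @MVT_segment R f _ 0 1 ler01 (fun t _ => df t).
  apply: continuous_subspaceT => t; apply: differentiable_continuous.
  by apply/derivable1_diffP; case: (df t).
rewrite subr0 mulr1 /f scale1r scale0r addr0 [x + (y - x)]addrC subrK => h.
by exists c.
Qed.

End Calculus.

(** * Bounded measurable functions and their integrals *)

Section BoundedMeasurable.
Context {dT : measure_display} {T : measurableType dT} {R : realType}.
Variables (P : probability T R) (D : set T).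
Hypothesis mD : measurable D.
Implicit Types (f g : T -> R) (C : R).

(** Under a probability measure this implies integrability and, unlike integrability, it is stable
    under products. *)
Definition bounded_measurable f :=
  measurable_fun D f /\ exists C, forall x, D x -> `|f x| <= C.

Lemma bounded_measurable_integrable f :
  bounded_measurable f -> P.-integrable D (EFin \o f).
Proof.
move=> [mf [C fC]]; apply: measurable_bounded_integrable => //.
  by rewrite (le_lt_trans (probability_le1 _ _)) ?ltry.
exists C; split; first exact: num_real.
by move=> A CA x /= Dx; rewrite (le_trans (fC _ Dx))// ltW.
Qed.

Lemma bounded_measurable_cst C : bounded_measurable (fun=> C).
Proof. by split; [exact: measurable_cst | exists `|C|]. Qed.

Lemma bounded_measurableD f g : bounded_measurable f -> bounded_measurable g ->
  bounded_measurable (fun x => f x + g x).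
Proof.
move=> [mf [A fA]] [mg [B gB]]; split; first exact: measurable_funD.
by exists (A + B) => x Dx; rewrite (le_trans (ler_normD _ _))// lerD ?fA ?gB.
Qed.

Lemma bounded_measurableM f g : bounded_measurable f -> bounded_measurable g ->
  bounded_measurable (fun x => f x * g x).
Proof.
move=> [mf [A fA]] [mg [B gB]]; split; first exact: measurable_funM.
by exists (A * B) => x Dx; rewrite normrM ler_pM ?fA ?gB.
Qed.

Lemma bounded_measurableZ C f : bounded_measurable f ->
  bounded_measurable (fun x => C * f x).
Proof. by apply: bounded_measurableM; exact: bounded_measurable_cst. Qed.

Lemma bounded_measurableB f g : bounded_measurable f -> bounded_measurable g ->
  bounded_measurable (fun x => f x - g x).
Proof.
move=> bf /(bounded_measurableZ (-1)) bg.
have := bounded_measurableD bf bg.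
by congr bounded_measurable; apply/funext => x; rewrite mulN1r.
Qed.

Lemma bounded_measurable_sum I (r : seq I) (f : I -> T -> R) :
  (forall i, bounded_measurable (f i)) ->
  bounded_measurable (fun x => \sum_(i <- r) f i x).
Proof.
move=> bf; elim: r => [|i r ih].
  have := bounded_measurable_cst 0.
  by congr bounded_measurable; apply/funext => x; rewrite big_nil.
have := bounded_measurableD (bf i) ih.
by congr bounded_measurable; apply/funext => x; rewrite big_cons.
Qed.

Lemma Rintegral_cst1 C : P D = 1%E -> \int[P]_(x in D) C = C.
Proof.
move=> D1; rewrite Rintegral_cst// -[RHS]mulr1; congr (_ * _).
exact: (congr1 fine D1).
Qed.

Lemma Rintegral_sum I (r : seq I) (f : I -> T -> R) :
  (forall i, bounded_measurable (f i)) ->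
  \int[P]_(x in D) (\sum_(i <- r) f i x) = \sum_(i <- r) \int[P]_(x in D) f i x.
Proof.
move=> bf; elim: r => [|i r ih].
  under eq_Rintegral do rewrite big_nil.
  by rewrite Rintegral_cst// mul0r big_nil.
under eq_Rintegral do rewrite big_cons.
rewrite RintegralD//; [by rewrite ih big_cons|..];
  apply: bounded_measurable_integrable => //.
exact: bounded_measurable_sum.
Qed.

End BoundedMeasurable.

(** * Change of variables to the law of a random variable *)

Section Distribution.
Context {dT d1 : measure_display} {T : measurableType dT}
  {T1 : measurableType d1} {R : realType}.
Variables (P : probability T R) (X : {RV P >-> T1}).

Lemma bounded_measurable_comp (f : T1 -> R) :
  bounded_measurable setT f -> bounded_measurable setT (f \o X).
Proof.
move=> [mf [C fC]]; split; last by exists C => x _; exact: fC.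
exact: measurableT_comp.
Qed.

Lemma Rintegral_distribution (f : T1 -> R) : bounded_measurable setT f ->
  \int[distribution P X]_y f y = \int[P]_w f (X w).
Proof.
move=> bf; rewrite /Rintegral (integral_distribution (f := EFin \o f))//.
  by case: bf => /measurable_EFinP.
exact/(bounded_measurable_integrable _ _ (bounded_measurable_comp bf)).
Qed.

End Distribution.

(** * Expectation of a product under independence *)

Section IndependentProduct.
Context {dT d1 d2 : measure_display} {T : measurableType dT}
  {T1 : measurableType d1} {T2 : measurableType d2} {R : realType}.
Variables (P : probability T R) (X : {RV P >-> T1}) (Y : {RV P >-> T2}).
Hypothesis XY : forall A B, measurable A -> measurable B ->
  P (X @^-1` A `&` Y @^-1` B) = (P (X @^-1` A) * P (Y @^-1` B))%E.

Let Z (w : T) : T1 * T2 := (X w, Y w).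

Let mZ : measurable_fun setT Z.
Proof. exact: measurable_fun_pair. Qed.

HB.instance Definition _ := isMeasurableFun.Build _ _ _ _ Z mZ.

(** The joint law of [X] and [Y] is the product of their laws, and Fubini then separates the two
    integrals. *)
Lemma independent_RintegralM (f : T1 -> R) (g : T2 -> R) :
  bounded_measurable setT f -> bounded_measurable setT g ->
  \int[P]_w (f (X w) * g (Y w)) = (\int[P]_w f (X w)) * \int[P]_w g (Y w).
Proof.
move=> bf bg.
pose fg (z : T1 * T2) : R := f z.1 * g z.2.
have bfg : bounded_measurable setT fg.
  case: bf bg => mf [A fA] [mg [B gB]]; split.
    by apply: measurable_funM; apply: measurableT_comp.
  by exists (A * B) => z _; rewrite normrM ler_pM ?fA ?gB.
rewrite -(Rintegral_distribution X bf) -(Rintegral_distribution Y bg).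
rewrite -(Rintegral_distribution (Z : {RV P >-> _}) bfg).
have -> : \int[distribution P (Z : {RV P >-> _})]_z fg z =
   \int[(distribution P X \x distribution P Y)%E]_z fg z.
  (* By [XY] the joint law has the product value on every measurable rectangle, which characterizes
     the product measure. *)
  congr fine; apply: eq_measure_integral => A mA _.
  apply/esym/product_measure_unique => // A1 A2 mA1 mA2; exact: XY.
have ifg : (distribution P X \x distribution P Y)%E.-integrable setT (EFin \o fg).
  exact: bounded_measurable_integrable.
rewrite {1}/Rintegral -integral12_prod_meas1//.
rewrite /fubini_F/= /fg/=.
under eq_integral => x _.
  under eq_integral do rewrite EFinM.
  rewrite integralZl//; last exact: bounded_measurable_integrable.
  rewrite -(fineK (x := \int[_]_y _)%E); last first.
    by apply: integrable_fin_num => //; exact: bounded_measurable_integrable.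
  over.
rewrite integralZr//; last exact: bounded_measurable_integrable.
rewrite fineM// ; apply: integrable_fin_num => //.
exact: bounded_measurable_integrable.
Qed.

End IndependentProduct.

(** * Continuity and Borel measurability on row vectors *)

Section Borel.
Context {R : realType} {d : nat}.

Lemma continuous_edot_fun (V : topologicalType) (f g : V -> 'rV[R]_d) :
  continuous f -> continuous g -> continuous (fun x => edot (f x) (g x)).
Proof.
move=> cf cg; rewrite /edot.
apply: (@continuous_big R 'I_d +%R 0 xpredT _ V _
  (fun j x => f x 0 j * g x 0 j)) => [|j _ x]; first exact: add_continuous.
by apply: cvgM; apply: (cvg_comp _ (fun y : 'rV[R]_d => y 0 j) (_ x));
  [exact: cf|exact: coord_continuous|exact: cg|exact: coord_continuous].
Qed.

Lemma continuous_edot (v : 'rV[R]_d) :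
  continuous (fun x : 'rV[R]_d => edot x v).
Proof. by apply: continuous_edot_fun => x //; exact: cst_continuous. Qed.

(** Neighbourhoods of a matrix are described entry by entry, and each entry of [y *m U] is the inner
    product of [y] with a fixed vector. *)
Lemma continuous_mulmxr (U : 'M[R]_d) : continuous (fun x : 'rV[R]_d => x *m U).
Proof.
move=> x A [B xB BA].
have FF : Filter (nbhs x) := nbhs_filter (x : 'rV[R]_d).
suff : nbhs x [set y : 'rV[R]_d | forall i j, B i j ((y *m U) i j)].
  by apply: (@filterS _ _ FF) => y; exact: BA.
apply: (@filter_forall _ _ (fun i y => forall j, B i j ((y *m U) i j))
  (nbhs x) FF) => i.
apply: (@filter_forall _ _ (fun j y => B i j ((y *m U) i j)) (nbhs x) FF) => j.
have xUE (y : 'rV[R]_d) : (y *m U) i j = edot y (delta_mx 0 j *m U^T).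
  by rewrite -edot_mulmx edot_delta ord1.
move: (xB i j); rewrite xUE => /continuous_edot.
by apply: (@filterS _ _ FF) => y /=; rewrite xUE.
Qed.

(** Open intervals generate the Borel sets of the line, and their preimages under [f] are open,
    hence among the generators of [borel_rV]. *)
Lemma continuous_borel_measurable (D : set (borel_rV R d)) (f : 'rV[R]_d -> R) :
  measurable D -> continuous f -> measurable_fun D (f : borel_rV R d -> R).
Proof.
move=> mD /continuousP cf; apply: (measurability _ (RGenOpens.measurableE R)).
move=> _ [_ [a [b ->] <-]]; apply: measurableI => //.
by apply: sub_gen_smallest; exact/cf/interval_open.
Qed.

Lemma measurable_mulmxr (U : 'M[R]_d) :
  measurable_fun setT
    (fun x : borel_rV R d => (x : 'rV[R]_d) *m U : borel_rV R d).
Proof.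
apply: (@measurability _ _ (borel_rV R d) (borel_rV R d) _ _
  (@open 'rV[R]_d)) => //.
move=> _ [B oB <-]; rewrite setTI; apply: sub_gen_smallest.
by move/continuousP : (@continuous_mulmxr U); exact.
Qed.

Lemma measurable_unit_sphere : measurable (@unit_sphere R d).
Proof.
have -> : @unit_sphere R d =
    setT `&` (fun x : borel_rV R d => edot (x : 'rV[R]_d) x) @^-1` [set 1].
  rewrite setTI; apply/seteqP; split=> x; rewrite /unit_sphere/= => x1.
    by rewrite -enorm_sqr x1 expr1n.
  by rewrite /enorm x1 sqrtr1.
by apply: continuous_borel_measurable => //; by apply: continuous_edot_fun => ?.
Qed.

End Borel.

(** * Invariant integration and second moments on the sphere *)

Section UniformSphere.
Context {R : realType} {d : nat}.
Variable mu : probability (borel_rV R d) R.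
Hypothesis mu_unif : uniform_sphere mu.
Implicit Types (x y z v w : 'rV[R]_d) (f : 'rV[R]_d -> R).
Local Notation S := (@unit_sphere R d).
Let mS := @measurable_unit_sphere R d.

Lemma sphere_orthogonal (U : 'M[R]_d) y : U *m U^T = 1%:M ->
  S (y *m U) = S y.
Proof. by move=> UU; rewrite /unit_sphere/= /enorm edot_orthogonal. Qed.

Lemma Rintegral_sphere_invariant (U : 'M[R]_d) f : U *m U^T = 1%:M ->
  bounded_measurable S f ->
  \int[mu]_(y in S) f (y *m U) = \int[mu]_(y in S) f y.
Proof.
move=> UU [mf [C fC]].
pose phi (y : borel_rV R d) : borel_rV R d := (y : 'rV[R]_d) *m U.
(* Extending [f] by zero gives an integral over the whole space, where the push-forward of [mu] by
   [phi] is [mu] itself; since [U] preserves the sphere, extension commutes with [phi]. *)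
pose g : borel_rV R d -> R := f \_ S.
have bg : bounded_measurable setT g.
  split; first by rewrite -measurable_restrictT.
  exists `|C| => y _; rewrite /g patchE; case: ifPn; last by rewrite normr0.
  by rewrite inE => /fC /le_trans; apply; exact: ler_norm.
have bgphi : bounded_measurable setT (g \o phi).
  split; last by case: bg => _ [A gA]; exists A => y _; exact: gA.
  by apply: measurableT_comp; [case: bg|exact: measurable_mulmxr].
have mphi : measurable_fun setT phi by exact: measurable_mulmxr.
have -> : \int[mu]_(y in S) f (y *m U) = \int[mu]_y g (phi y).
  rewrite Rintegral_mkcond; apply: eq_Rintegral => y _.
  rewrite /g !patchE; have -> // : (phi y \in S) = (y \in S).
  by apply/idP/idP; rewrite !inE sphere_orthogonal.
rewrite [RHS]Rintegral_mkcond.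
rewrite /Rintegral -(@integral_pushforward _ _ _ _ _ phi _ mu setT (EFin \o g))//.
- congr fine; apply: eq_measure_integral => A mA _; exact: mu_unif.2.
- by case: bg => /measurable_EFinP.
- exact: (bounded_measurable_integrable _ _ bgphi).
Qed.

Lemma bounded_edot v : bounded_measurable S (fun y => edot (y : 'rV[R]_d) v).
Proof.
split; first by apply: continuous_borel_measurable => //; exact: continuous_edot.
by exists (enorm v) => y Sy; rewrite (le_trans (edot_le_enorm _ _))// Sy mul1r.
Qed.

Lemma bounded_edot2 v :
  bounded_measurable S (fun y => edot (y : 'rV[R]_d) v ^+ 2).
Proof. by apply: bounded_measurableM; exact: bounded_edot. Qed.

Lemma bounded_coord2 (k : 'I_d) :
  bounded_measurable S (fun y => (y : 'rV[R]_d) 0 k ^+ 2).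
Proof.
have := bounded_edot2 (delta_mx 0 k).
by congr bounded_measurable; apply/funext => y; rewrite edot_delta.
Qed.

(** The reflection across the hyperplane orthogonal to [v - w] exchanges [v] and [w] when their
    lengths agree, and it preserves the integral. *)
Lemma Rintegral_sphere_edot2_norm v w : edot v v = edot w w ->
  \int[mu]_(y in S) edot y v ^+ 2 = \int[mu]_(y in S) edot y w ^+ 2.
Proof.
move=> vw; pose U := householder (v - w).
have UU : U *m U^T = 1%:M by exact: householder_orthogonal.
rewrite -(Rintegral_sphere_invariant UU (bounded_edot2 w)).
apply: eq_Rintegral => y _.
by rewrite edot_mulmx householder_tr householder_swap.
Qed.

(** For each [k], [v] may be replaced by [enorm v] times the [k]-th basis vector. Summing over the
    [d] values of [k] yields the integral of the sum of squared coordinates, which is 1 on the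
    sphere. *)
Lemma Rintegral_sphere_edot2 v :
  d%:R * \int[mu]_(y in S) edot y v ^+ 2 = edot v v.
Proof.
have vE (k : 'I_d) : \int[mu]_(y in S) edot y v ^+ 2 =
    edot v v * \int[mu]_(y in S) (y : 'rV[R]_d) 0 k ^+ 2.
  rewrite (@Rintegral_sphere_edot2_norm v (enorm v *: delta_mx 0 k)); last first.
    rewrite edotZl edotZr mulrA -expr2 enorm_sqr edot_delta mxE.
    by rewrite !eqxx mulr1.
  rewrite -RintegralZl//; last first.
    exact: (bounded_measurable_integrable _ mS (bounded_coord2 k)).
  apply: eq_Rintegral => y _.
  by rewrite edotZr edot_delta exprMn enorm_sqr.
have -> : d%:R * \int[mu]_(y in S) edot y v ^+ 2 =
    \sum_(k < d) \int[mu]_(y in S) edot y v ^+ 2.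
  by rewrite sumr_const card_ord mulr_natl.
under eq_bigr => k _ do rewrite (vE k).
rewrite -big_distrr /= -Rintegral_sum//; last exact: bounded_coord2.
rewrite -[RHS]mulr1 -[X in _ = _ * X](Rintegral_cst1 mS _ mu_unif.1).
congr (_ * _); apply: eq_Rintegral => y /set_mem Sy.
by rewrite -[RHS](expr1n _ 2) -Sy enorm_sqr.
Qed.
End UniformSphere.

(** * Increments of a smooth function and the error of one sample *)

Section OneSample.
Context {R : realType} {d : nat}.
Variables (F : 'rV[R]_d -> R) (L : R).
Hypothesis dF : forall z, differentiable F z.
Hypothesis F_lip : forall x y, enorm (grad F x - grad F y) <= L * enorm (x - y).
Hypothesis L0 : 0 <= L.
Hypothesis d0 : (0 < d)%N.
Implicit Types (x y z v a b : 'rV[R]_d) (h : R).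

(** The mean value theorem evaluates the gradient on the segment from [a] to [b], which by convexity
    stays within [h] of [x]. Separating the base point [x] from [a] covers both the increment from
    [x] and the one between two mirrored points. *)
Lemma increment_approx x h a b : enorm (a - x) <= h -> enorm (b - x) <= h ->
  `|F b - F a - edot (grad F x) (b - a)| <= L * h * enorm (b - a).
Proof.
move=> ax bx; have [c /[!in_itv]/= /andP[c0 c1] ->] := differentiable_MVT a b dF.
rewrite -edotBl (le_trans (edot_le_enorm _ _))// ler_wpM2r ?enorm_ge0//.
rewrite (le_trans (F_lip _ _))// ler_wpM2l//.
have -> : a + c *: (b - a) - x = (1 - c) *: (a - x) + c *: (b - x).
  by apply/rowP => j; rewrite !mxE; ring.
rewrite (le_trans (enormD _ _))// !enormZ !ger0_norm ?subr_ge0//.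
have -> : h = (1 - c) * h + c * h by ring.
by rewrite lerD// ler_wpM2l ?subr_ge0.
Qed.

Definition sample_error h x y : 'rV[R]_d :=
  (d%:R / h * (F (x + h *: y) - F x)) *: y - grad F x.

Lemma sphere_increment_bound h x y : 0 < h -> enorm y = 1 ->
  `|F (x + h *: y) - F x| <= h * (enorm (grad F x) + L * h).
Proof.
move=> h0 y1.
have xx : enorm (x - x) <= h by rewrite subrr enorm0 ltW.
have hy : enorm (h *: y) = h by rewrite enormZ y1 mulr1 gtr0_norm.
have xhy : x + h *: y - x = h *: y by rewrite addrAC subrr add0r.
have yx : enorm (x + h *: y - x) <= h by rewrite xhy hy.
have := increment_approx xx yx; rewrite xhy hy => le1.
rewrite -[X in `|X|](subrK (edot (grad F x) (h *: y))).
rewrite (le_trans (ler_normD _ _))//.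
have := edot_le_enorm (grad F x) (h *: y); rewrite hy; lra.
Qed.

(** The increment is of order [h], which cancels the division by [h]. The subtracted gradient is
    absorbed through [1 <= d%:R], whence the factor 2. *)
Lemma sample_error_bound h x y : 0 < h -> enorm y = 1 ->
  enorm (sample_error h x y) <= d%:R * (2 * enorm (grad F x) + L * h).
Proof.
move=> h0 y1; rewrite (le_trans (enormB _ _))// enormZ y1 mulr1 normrM.
have d1 : 1 <= d%:R :> R by rewrite ler1n.
rewrite ger0_norm ?divr_ge0 ?ler0n ?(ltW h0)//.
have le1 : d%:R / h * `|F (x + h *: y) - F x| <=
    d%:R * (enorm (grad F x) + L * h).
  rewrite -mulrA ler_wpM2l ?ler0n// mulrC ler_pdivrMr// mulrC.
  exact: sphere_increment_bound.
have : enorm (grad F x) <= d%:R * enorm (grad F x).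
  by rewrite ler_peMl ?enorm_ge0.
lra.
Qed.

Lemma continuous_shift_scale h x : continuous (fun y => F (x + h *: y)).
Proof.
move=> y; apply: (@continuous_comp _ _ _ (fun y => x + h *: y) F).
  apply: (@continuousD _ _ _ (cst x) ( *:%R h)); first exact: cst_continuous.
  exact: scaler_continuous.
exact: differentiable_continuous.
Qed.

Lemma continuous_increment h x :
  continuous (fun y => F (x + h *: y) - F x).
Proof.
move=> y; apply: (@continuousB _ _ _ (fun y => F (x + h *: y)) (cst (F x))).
  exact: continuous_shift_scale.
exact: cst_continuous.
Qed.

Lemma continuous_increment_edot h x v :
  continuous (fun y => (F (x + h *: y) - F x) * edot y v).
Proof.
move=> y; apply: (@continuousM _ _ (fun y => F (x + h *: y) - F x)
  (fun y => edot y v)).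
  exact: continuous_increment.
exact: continuous_edot.
Qed.

Lemma continuous_sample_error h x v :
  continuous (fun y => edot (sample_error h x y) v).
Proof.
have -> : (fun y => edot (sample_error h x y) v) = (fun y =>
    d%:R / h * ((F (x + h *: y) - F x) * edot y v) - edot (grad F x) v).
  by apply/funext => y; rewrite edotBl edotZl mulrA.
move=> y; apply: (@continuousB _ _ _
    (fun y => d%:R / h * ((F (x + h *: y) - F x) * edot y v)) (cst _)).
  apply: (@continuousM _ _ (cst _)
    (fun y => (F (x + h *: y) - F x) * edot y v)).
    exact: cst_continuous.
  exact: continuous_increment_edot.
exact: cst_continuous.
Qed.

(** * Bias of one sample under the uniform law *)

Section Bias.
Variable mu : probability (borel_rV R d) R.
Hypothesis mu_unif : uniform_sphere mu.
Local Notation S := (@unit_sphere R d).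
Let mS := @measurable_unit_sphere R d.

Lemma bounded_increment h x : 0 < h ->
  bounded_measurable S (fun y => F (x + h *: (y : 'rV[R]_d)) - F x).
Proof.
move=> h0; split; last first.
  by exists (h * (enorm (grad F x) + L * h)) => y; exact: sphere_increment_bound.
apply: continuous_borel_measurable => //; exact: continuous_increment.
Qed.

Lemma bounded_sample_error h x v : 0 < h ->
  bounded_measurable S (fun y => edot (sample_error h x y) v).
Proof.
move=> h0; split.
  by apply: continuous_borel_measurable => //; exact: continuous_sample_error.
exists (d%:R * (2 * enorm (grad F x) + L * h) * enorm v) => y Sy.
apply: le_trans (edot_le_enorm _ _) _; rewrite ler_wpM2r ?enorm_ge0//.
exact: sample_error_bound.
Qed.

(** Bounding every scalar projection of the mean error, rather than its norm, lets the reflection be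
    adapted to [v]. *)
Lemma sample_bias h x v : 0 < h ->
  `|\int[mu]_(y in S) edot (sample_error h x y) v| <= L * h * enorm v.
Proof.
move=> h0; have [->|v0] := eqVneq v 0.
  have -> : \int[mu]_(y in S) edot (sample_error h x y) 0 = 0.
    under eq_Rintegral do rewrite edotC edot0l.
    by rewrite Rintegral_cst// mul0r.
  by rewrite normr0 enorm0 mulr0.
set G := grad F x; set c : R := d%:R / h.
have dR0 : d%:R != 0 :> R by rewrite pnatr_eq0 -lt0n.
have dgt0 : 0 < d%:R :> R by rewrite ltr0n.
have hN0 : h != 0 by rewrite gt_eqF.
have nv0 : enorm v != 0 by rewrite enorm_eq0.
have nvgt0 : 0 < enorm v by rewrite lt_neqAle eq_sym nv0 enorm_ge0.
pose f y := (F (x + h *: y) - F x) * edot y v.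
have bf : bounded_measurable S f.
  by apply: bounded_measurableM; [exact: bounded_increment|exact: bounded_edot].
pose A := \int[mu]_(y in S) f y.
have intE : \int[mu]_(y in S) edot (sample_error h x y) v = c * A - edot G v.
  have -> : \int[mu]_(y in S) edot (sample_error h x y) v =
      \int[mu]_(y in S) (c * f y - edot G v).
    by apply: eq_Rintegral => y _; rewrite edotBl edotZl /f mulrA.
  rewrite RintegralB//; last 2 first.
  - exact/(bounded_measurable_integrable _ mS (bounded_measurableZ _ bf)).
  - exact/(bounded_measurable_integrable _ mS (bounded_measurable_cst _ _)).
  rewrite (Rintegral_cst1 mS _ mu_unif.1) RintegralZl//.
  exact: (bounded_measurable_integrable _ mS bf).
pose W := householder v.
have WW : W *m W^T = 1%:M := householder_orthogonal v.
pose q := \int[mu]_(y in S) edot y v ^+ 2.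
have qE : q = enorm v ^+ 2 / d%:R.
  by rewrite enorm_sqr -(Rintegral_sphere_edot2 mu_unif v) mulrAC mulfV// mul1r.
(* Along the reflection [y] moves by a multiple of [v] proportional to [edot y v]. Hence the
   first-order part of the symmetrized integrand is [k * edot y v ^+ 2], and [e] is the matching
   coefficient for the remainder given by [increment_approx]. *)
pose k : R := 2 * h * edot G v / enorm v ^+ 2.
pose e : R := 2 * L * h ^+ 2 / enorm v.
have bfW : bounded_measurable S (fun y => f ((y : 'rV[R]_d) *m W)).
  case: bf => mf [C fC]; split; last first.
    by exists C => y Sy; apply: fC; rewrite sphere_orthogonal.
  apply: continuous_borel_measurable => // y.
  apply: (@continuous_comp _ _ _ (fun y : 'rV[R]_d => y *m W) f).
    exact: continuous_mulmxr.
  exact: continuous_increment_edot.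
pose r y := f y + f (y *m W) - k * edot y v ^+ 2.
have br : bounded_measurable S r.
  apply: bounded_measurableB; first exact: bounded_measurableD.
  by apply: bounded_measurableZ; exact: bounded_edot2.
have rE : \int[mu]_(y in S) r y = 2 * A - k * q.
  rewrite RintegralB//; last 2 first.
  - exact/(bounded_measurable_integrable _ mS (bounded_measurableD bf bfW)).
  - apply/(bounded_measurable_integrable _ mS)/bounded_measurableZ.
    exact: bounded_edot2.
  rewrite RintegralD//; last 2 first.
  - exact/(bounded_measurable_integrable _ mS bf).
  - exact/(bounded_measurable_integrable _ mS bfW).
  rewrite (Rintegral_sphere_invariant mu_unif WW bf) RintegralZl//; last first.
    exact/(bounded_measurable_integrable _ mS (bounded_edot2 _)).
  by rewrite -/A -/q; ring.
(* Since [edot (y *m W) v = - edot y v], the two occurrences of [F x] cancel in [f y + f (y *m W)],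
   leaving the increment between the mirrored points times [edot y v]. *)
have r_le y : S y -> `|r y| <= e * edot y v ^+ 2.
  move=> Sy.
  have yW : y *m W = y - (2 * edot y v / edot v v) *: v := mul_householder y v.
  set t := 2 * edot y v / edot v v in yW.
  have yWv : edot (y *m W) v = - edot y v.
    rewrite yW edotBl edotZl /t divfK; last by rewrite edot_eq0.
    by ring.
  have near z : S z -> enorm (x + h *: z - x) <= h.
    by move=> Sz; rewrite addrAC subrr add0r enormZ Sz mulr1 gtr0_norm.
  have := increment_approx (near _ _) (near _ Sy).
  move=> /(_ (y *m W)); rewrite sphere_orthogonal// => /(_ Sy).
  have -> : x + h *: y - (x + h *: (y *m W)) = (h * t) *: v.
    by rewrite yW; apply/rowP => j; rewrite !mxE; ring.
  rewrite edotZr enormZ => le1.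
  have -> : r y = (F (x + h *: y) - F (x + h *: (y *m W))
      - h * t * edot (grad F x) v) * edot y v.
    rewrite /r /f yWv /k /t enorm_sqr -/G; field.
    by rewrite edot_eq0.
  rewrite normrM; apply: le_trans (ler_wpM2r (normr_ge0 _) le1) _.
  rewrite le_eqVlt; apply/orP; left; apply/eqP.
  rewrite /t !normrM normfV -enorm_sqr [`|enorm v ^+ 2|]ger0_norm ?sqr_ge0//.
  rewrite (gtr0_norm h0) [`|2|]ger0_norm//.
  have -> : edot y v ^+ 2 = `|edot y v| ^+ 2 by rewrite real_normK ?num_real.
  by rewrite /e; field.
have le1 : `|2 * A - k * q| <= e * q.
  rewrite -rE; apply: le_trans (le_normr_Rintegral _ _) _ => //.
    exact: (bounded_measurable_integrable _ mS br).
  have be : bounded_measurable S (fun y => e * edot (y : 'rV[R]_d) v ^+ 2).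
    by apply: bounded_measurableZ; exact: bounded_edot2.
  rewrite /q -RintegralZl//; last first.
    exact: (bounded_measurable_integrable _ mS (bounded_edot2 _)).
  apply: le_Rintegral => //.
  - apply: (bounded_measurable_integrable _ mS).
    case: br => mr [C rC]; split; first exact: measurableT_comp.
    by exists C => y Sy; rewrite normr_id rC.
  - exact: (bounded_measurable_integrable _ mS be).
rewrite intE.
have c2 : 0 < c / 2 by rewrite !divr_gt0.
(* The value of [q] gives [c / 2 * (k * q) = edot G v]: the first-order part accounts exactly for
   the gradient. *)
have -> : c * A - edot G v = c / 2 * (2 * A - k * q).
  by rewrite qE /k /c; field; rewrite hN0 nv0 dR0.
rewrite normrM (gtr0_norm c2); apply: le_trans (ler_wpM2l (ltW c2) le1) _.
rewrite le_eqVlt; apply/orP; left; apply/eqP.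
(* The factor [d%:R] in [c] cancels the [1 / d%:R] in [q], which makes the bias bound free of the
   dimension. *)
by rewrite qE /e /c; field; rewrite hN0 nv0 dR0.
Qed.

End Bias.
End OneSample.

(** * Second moment of an average of uncorrelated vectors *)

Section SecondMoment.
Context {dT : measure_display} {T : measurableType dT} {R : realType}.
Context {d s : nat}.
Variables (P : probability T R) (X : 'I_s -> T -> 'rV[R]_d).
Hypothesis bX : forall i k, bounded_measurable setT (fun w => X i w 0 k).
Hypothesis X_uncorrelated : forall i j k, i != j ->
  \int[P]_w (X i w 0 k * X j w 0 k) =
  (\int[P]_w X i w 0 k) * \int[P]_w X j w 0 k.
Hypothesis s0 : (0 < s)%N.

(** Expanding the square gives [s ^ 2] inner products: only the [s] diagonal ones feel the uniform
    bound [C], the others factor into inner products of means. *)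
Lemma second_moment_average (C B : R) :
  (forall i w, enorm (X i w) <= C) ->
  (forall i, enorm (\row_k \int[P]_w X i w 0 k) <= B) ->
  \int[P]_w enorm (s%:R^-1 *: \sum_(i < s) X i w) ^+ 2 <=
    C ^+ 2 / s%:R + B ^+ 2.
Proof.
move=> XC XB; have sR0 : s%:R != 0 :> R by rewrite pnatr_eq0 -lt0n.
have bXX i j : bounded_measurable setT (fun w => edot (X i w) (X j w)).
  apply: bounded_measurable_sum => k; exact: bounded_measurableM.
have bXs i : bounded_measurable setT (fun w => \sum_(j < s) edot (X i w) (X j w)).
  exact: bounded_measurable_sum.
(* Allowing [B ^+ 2] on the diagonal as well makes the bounds sum to exactly
   [s%:R * C ^+ 2 + s%:R ^+ 2 * B ^+ 2]. *)
have XX_le i j : \int[P]_w edot (X i w) (X j w) <= (i == j)%:R * C ^+ 2 + B ^+ 2.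
  have [->|ij] := eqVneq i j.
    rewrite mul1r; apply: (@le_trans _ _ (C ^+ 2)); last by rewrite lerDl sqr_ge0.
    have <- : \int[P]_w (C ^+ 2) = C ^+ 2.
      by rewrite Rintegral_cst1// probability_setT.
    apply: le_Rintegral => //.
    - exact: (bounded_measurable_integrable _ _ (bXX _ _)).
    - exact: (bounded_measurable_integrable _ _ (bounded_measurable_cst _ _)).
    - move=> w _; rewrite -enorm_sqr ler_pXn2r ?nnegrE ?enorm_ge0//.
      exact: le_trans (enorm_ge0 _) (XC j w).
  rewrite mul0r add0r; pose e l := \row_k \int[P]_w X l w 0 k.
  have -> : \int[P]_w edot (X i w) (X j w) = edot (e i) (e j).
    rewrite Rintegral_sum//; last by move=> k; exact: bounded_measurableM.
    by apply: eq_bigr => k _; rewrite X_uncorrelated// !mxE.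
  rewrite (le_trans (ler_norm _))// (le_trans (edot_le_enorm _ _))//.
  by rewrite expr2 ler_pM ?enorm_ge0// XB.
have -> : \int[P]_w enorm (s%:R^-1 *: \sum_(i < s) X i w) ^+ 2 =
    \int[P]_w (s%:R^-1 ^+ 2 * \sum_(i < s) \sum_(j < s) edot (X i w) (X j w)).
  apply: eq_Rintegral => w _.
  rewrite enorm_sqr edotZl edotZr mulrA -expr2 edot_suml.
  by congr (_ * _); apply: eq_bigr => i _; rewrite edot_sumr.
rewrite RintegralZl//; last first.
  exact/(bounded_measurable_integrable _ _ (bounded_measurable_sum _ bXs)).
rewrite Rintegral_sum//; under eq_bigr do rewrite Rintegral_sum//.
have sum_le : \sum_(i < s) \sum_(j < s) \int[P]_w edot (X i w) (X j w) <=
    s%:R * C ^+ 2 + s%:R ^+ 2 * B ^+ 2.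
  have -> : s%:R * C ^+ 2 + s%:R ^+ 2 * B ^+ 2 =
      \sum_(i < s) \sum_(j < s) ((i == j)%:R * C ^+ 2 + B ^+ 2).
    under eq_bigr => i _.
      rewrite big_split /= -big_distrl /= (bigD1 i)//= eqxx big1 ?addr0 ?mul1r.
        rewrite sumr_const card_ord; over.
      by move=> j; rewrite eq_sym => /negbTE ->.
    by rewrite sumr_const card_ord -[RHS]mulr_natl -mulr_natl; ring.
  by apply: ler_sum => i _; apply: ler_sum => j _.
apply: le_trans (ler_wpM2l (sqr_ge0 _) sum_le) _.
by rewrite le_eqVlt; apply/orP; left; apply/eqP; field.
Qed.

End SecondMoment.

(** Mutual independence is applied to the index set of [i] and [j], with [A] placed at [i] and [B]
    at every other index. *)
Lemma pairwise_independent (dT dE : measure_display)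
    (T : measurableType dT) (E : measurableType dE) (R : realType)
    (P : probability T R) (s : nat) (u : 'I_s -> {RV P >-> E}) (i j : 'I_s) :
  mutually_independent u -> i != j ->
  forall A B, measurable A -> measurable B ->
  P (u i @^-1` A `&` u j @^-1` B) = (P (u i @^-1` A) * P (u j @^-1` B))%E.
Proof.
move=> u_indep ij A B mA mB.
have ji : (j == i) = false by rewrite eq_sym (negbTE ij).
pose Bs k := if k == i then A else B.
have := u_indep [set i; j]%SET Bs.
rewrite big_setU1 ?inE// big_set1 /Bs eqxx ji => <-; last first.
  by move=> k; case: ifP.
congr (P _); apply/seteqP; split=> w /=.
  move=> [iA jB] k /=; rewrite !inE => /orP[]/eqP ->; first by rewrite eqxx.
  by rewrite ji.
move=> h; split; first by have := h i; rewrite /= !inE !eqxx; exact.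
by have := h j; rewrite /= !inE eqxx orbT ji; exact.
Qed.

Lemma grad_growth (R : realType) (d : nat) (F : 'rV[R]_d -> R) (m b L : R) :
  0 < m -> 0 <= b -> 0 <= L -> dissipative m b F ->
  (forall x y, enorm (grad F x - grad F y) <= L * enorm (x - y)) ->
  forall x, enorm (grad F x) <= L * enorm x + (b + L).
Proof.
move=> m0 b0 L0 dissF F_lip x; set g := grad F 0.
have g_le : enorm g <= b + L.
  have [->|gN0] := eqVneq g 0; first by rewrite enorm0 addr_ge0.
  have ng0 : enorm g != 0 by rewrite enorm_eq0.
  (* At this unit vector [edot y g = - enorm g], so dissipativity and the Lipschitz bound give
     [m - b <= L - enorm g]; then [0 < m] concludes. *)
  pose y := - (enorm g)^-1 *: g.
  have y1 : enorm y = 1.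
    by rewrite enormZ normrN ger0_norm ?invr_ge0 ?enorm_ge0// mulVf.
  have := dissF y; rewrite y1 expr1n mulr1.
  have -> : edot y (grad F y) = edot y (grad F y - g) - enorm g.
    rewrite edotBr -addrA -[LHS]addr0; congr (_ + _).
    by rewrite /y edotZl -enorm_sqr; field.
  have := le_trans (ler_norm _) (edot_le_enorm y (grad F y - g)).
  have := F_lip y 0; rewrite subr0 y1 -/g; lra.
rewrite -[grad F x](subrK g) (le_trans (enormD _ _))// lerD//.
by have := F_lip x 0; rewrite subr0.
Qed.

(** * Mean squared error of the estimator *)

Section Estimator.
Context {dT : measure_display} {T : measurableType dT} {R : realType}.
Context {d s : nat}.
Variables (P : probability T R) (F : 'rV[R]_d -> R) (L h : R).
Variable u : 'I_s -> {RV P >-> borel_rV R d}.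
Hypothesis dF : forall z, differentiable F z.
Hypothesis F_lip : forall x y, enorm (grad F x - grad F y) <= L * enorm (x - y).
Hypotheses (L0 : 0 <= L) (d0 : (0 < d)%N) (s0 : (0 < s)%N) (h0 : 0 < h).
Hypothesis u_unif : forall i, uniform_sphere (distribution P (u i)).
Hypothesis u_indep : mutually_independent u.
Local Notation S := (@unit_sphere R d).
Let mS := @measurable_unit_sphere R d.

Lemma sphere_estimator_error x (y : 'I_s -> 'rV[R]_d) :
  sphere_estimator F h y x - grad F x =
  s%:R^-1 *: \sum_(i < s) sample_error F h x (y i).
Proof.
rewrite sumrB scalerBr; congr (_ - _).
rewrite sumr_const card_ord -[grad F x *+ s]scaler_nat scalerA mulVf.
  by rewrite scale1r.
by rewrite pnatr_eq0 -lt0n.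
Qed.

(** Each sample leaves the sphere on a null event only, and there are finitely many samples. *)
Lemma sphere_ae : {ae P, forall w, forall i, S (u i w)}.
Proof.
apply: filter_forall => i; exists (u i @^-1` ~` S); split.
- by apply: measurable_funPTI; exact: measurableC.
- rewrite -[LHS]/(distribution P (u i) (~` S)) probability_setC//.
  by rewrite (u_unif i).1 subee.
- by [].
Qed.

Lemma expectation_sphere_estimator x :
  ('E_P[(fun w => (enorm (sphere_estimator F h (fun i => u i w) x - grad F x)
      ^+ 2)%R)] <=
   ((d%:R * (2 * enorm (grad F x) + L * h)) ^+ 2 / s%:R + (L * h) ^+ 2)%:E)%E.
Proof.
set C := d%:R * (2 * enorm (grad F x) + L * h).
have C0 : 0 <= C.
  by rewrite mulr_ge0 ?ler0n// addr_ge0 ?mulr_ge0 ?enorm_ge0// ltW.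
pose psi (k : 'I_d) (y : borel_rV R d) : R := sample_error F h x y 0 k.
have mpsi k : measurable_fun setT (psi k).
  have -> : psi k = fun y => edot (sample_error F h x y) (delta_mx 0 k).
    by apply/funext => y; rewrite edot_delta.
  by apply: continuous_borel_measurable => //; exact: continuous_sample_error.
have bpsi k : bounded_measurable S (psi k).
  have := bounded_sample_error dF F_lip L0 d0 x (delta_mx 0 k) h0.
  by congr bounded_measurable; apply/funext => y; rewrite edot_delta.
have bpsiS k : bounded_measurable setT (psi k \_ S).
  case: (bpsi k) => mpsiS [A psiA]; split; first by rewrite -measurable_restrictT.
  exists `|A| => y _; rewrite patchE; case: ifPn; last by rewrite normr0.
  by rewrite inE => /psiA /le_trans; apply; exact: ler_norm.
(* The bound [C] holds only for samples on the sphere. Setting the error to zero elsewhere makes it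
   valid for every [w] and alters the error on a null event only. *)
pose X (i : 'I_s) (w : T) : 'rV[R]_d :=
  if u i w \in S then sample_error F h x (u i w) else 0.
have XE i k w : X i w 0 k = (psi k \_ S) (u i w).
  by rewrite /X patchE; case: ifP => // _; rewrite mxE.
have bX i k : bounded_measurable setT (fun w => X i w 0 k).
  have := bounded_measurable_comp (u i) (bpsiS k).
  by congr bounded_measurable; apply/funext => w; rewrite XE.
have IX i k : \int[P]_w X i w 0 k =
    \int[distribution P (u i)]_(y in S) psi k y.
  rewrite [RHS]Rintegral_mkcond (Rintegral_distribution _ (bpsiS k)).
  by apply: eq_Rintegral => w _; rewrite XE.
have X_uncorr i j k : i != j -> \int[P]_w (X i w 0 k * X j w 0 k) =
    (\int[P]_w X i w 0 k) * \int[P]_w X j w 0 k.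
  move=> ij.
  have -> : \int[P]_w (X i w 0 k * X j w 0 k) =
      \int[P]_w ((psi k \_ S) (u i w) * (psi k \_ S) (u j w)).
    by apply: eq_Rintegral => w _; rewrite !XE.
  rewrite independent_RintegralM//; last exact: pairwise_independent.
  by congr (_ * _); apply: eq_Rintegral => w _; rewrite XE.
have XC i w : enorm (X i w) <= C.
  rewrite /X; case: ifPn => [/set_mem Sy|_]; last by rewrite enorm0.
  exact: sample_error_bound.
(* The bias estimate is applied with the mean error [e] itself as direction: it bounds
   [enorm e ^+ 2] by [L * h * enorm e], and one factor [enorm e] is divided out. *)
have XB i : enorm (\row_k \int[P]_w X i w 0 k) <= L * h.
  set e := \row_k _.
  have [e0|eN0] := eqVneq (enorm e) 0.
    by rewrite e0 mulr_ge0// ltW.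
  have egt0 : 0 < enorm e by rewrite lt_neqAle eq_sym eN0 enorm_ge0.
  rewrite -(ler_pM2r egt0) -expr2 enorm_sqr.
  apply: le_trans (sample_bias dF F_lip L0 d0 (u_unif i) x e h0).
  apply: le_trans (ler_norm _); rewrite le_eqVlt; apply/orP; left; apply/eqP.
  rewrite /edot Rintegral_sum//; last first.
    move=> k; apply: bounded_measurableM; first exact: bpsi.
    exact: bounded_measurable_cst.
  apply: eq_bigr => k _; rewrite RintegralZr//.
    by rewrite {1}mxE IX.
  exact: (bounded_measurable_integrable _ mS (bpsi k)).
have bXX i j : bounded_measurable setT (fun w => edot (X i w) (X j w)).
  apply: bounded_measurable_sum => k; exact: bounded_measurableM.
pose avg w := enorm (s%:R^-1 *: \sum_(i < s) X i w) ^+ 2.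
have bavg : bounded_measurable setT avg.
  have -> : avg = (fun w => s%:R^-1 ^+ 2 *
      \sum_(i < s) \sum_(j < s) edot (X i w) (X j w)).
    apply/funext => w.
    rewrite /avg enorm_sqr edotZl edotZr mulrA -expr2 edot_suml.
    by congr (_ * _); apply: eq_bigr => i _; rewrite edot_sumr.
  apply: bounded_measurableZ; apply: bounded_measurable_sum => i.
  exact: bounded_measurable_sum.
rewrite unlock.
have -> : (\int[P]_w (enorm (sphere_estimator F h (fun i => u i w) x -
    grad F x) ^+ 2)%:E = \int[P]_w (avg w)%:E)%E.
  apply: ae_eq_integral => //.
  - apply/measurable_EFinP.
    (* Almost everywhere equality of integrals also requires the untruncated error to be measurable,
       which is read off from its expansion into products of coordinates. *)
    have -> : (fun w => enorm (sphere_estimator F h (fun i => u i w) x -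
        grad F x) ^+ 2) = (fun w => s%:R^-1 ^+ 2 *
        \sum_(i < s) \sum_(j < s) \sum_(k < d) psi k (u i w) * psi k (u j w)).
      apply/funext => w; rewrite sphere_estimator_error.
      rewrite enorm_sqr edotZl edotZr mulrA -expr2 edot_suml.
      by congr (_ * _); apply: eq_bigr => i _; rewrite edot_sumr.
    apply: measurable_funM => //; do 3 apply: measurable_sum => ?.
    by apply: measurable_funM; apply: measurableT_comp.
  - by case: bavg => /measurable_EFinP.
  - apply: filterS sphere_ae => w Sw _; rewrite sphere_estimator_error.
    congr (enorm (_ *: _) ^+ 2)%:E; apply: eq_bigr => i _.
    by rewrite /X mem_set.
(* The truncated integrand is bounded, so its integral is finite and the comparison can be made in
   [R]. *)
rewrite -(fineK (x := \int[P]_w _)%E); last first.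
  apply: integrable_fin_num => //.
  exact: (bounded_measurable_integrable _ _ bavg).
rewrite lee_fin; exact: second_moment_average.
Qed.

End Estimator.

(** * Constants uniform in the dimension, the step and the sample size *)

Unset Implicit Arguments.

Theorem lemma4p5 (R : realType) (M m b : R) (hm : 0 < m) (hb : 0 < b) :
  exists PS QS : R,
    [/\ 0 <= PS, 0 <= QS
      & forall (d : nat) (F : 'rV[R]_d -> R),
          (0 < d)%N -> smooth M F -> dissipative m b F ->
        forall beta gamma h : R,
          0 < beta -> 0 < gamma -> 0 < h -> h <= 1 ->
        forall (dT : measure_display) (T : measurableType dT)
               (P : probability T R) (s : nat)
               (u : 'I_s -> {RV P >-> borel_rV R d}),
          (0 < s)%N ->
          (forall i, uniform_sphere (distribution P (u i))) ->
          mutually_independent u ->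
        let g := fun (x : 'rV[R]_d) (w : T) =>
          sphere_estimator F h (fun i => u i w) x in
        let deltaS := d%:R ^+ 2 / s%:R + h ^+ 2 in
        (forall x : 'rV[R]_d,
           ('E_P[(fun w => (enorm (g x w - grad F x) ^+ 2)%R)]
              <= (deltaS * (PS * enorm x ^+ 2 + QS))%:E)%E)
        /\ controlled_growth P F g deltaS PS QS].
Proof.
(* No sign is assumed on [M]; its absolute value is still a Lipschitz constant. With [h <= 1],
   [grad_growth] gives [2 * enorm (grad F x) + L * h <= 2 * L * enorm x + a], as
   [a = 2 * (b + L) + L]. *)
pose L := `|M|; pose a := 2 * b + 3 * L.
have L0 : 0 <= L by exact: normr_ge0.
have PS0 : 0 <= 8 * L ^+ 2 by rewrite mulr_ge0 ?sqr_ge0.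
have QS0 : 0 <= 2 * a ^+ 2 + L ^+ 2.
  by rewrite addr_ge0 ?sqr_ge0// mulr_ge0 ?sqr_ge0.
(* The terms with 8 and 2 come from [(p + q) ^+ 2 <= 2 * p ^+ 2 + 2 * q ^+ 2] with
   [p = 2 * L * enorm x] and [q = a]; the extra [L ^+ 2] covers the squared bias. *)
exists (8 * L ^+ 2), (2 * a ^+ 2 + L ^+ 2); split=> //.
move=> d F d0 [dF _ F_lipM] F_diss _ _ h _ _ h0 h1 dT T P s u s0 u_unif u_indep.
move=> g deltaS.
have F_lip x y : enorm (grad F x - grad F y) <= L * enorm (x - y).
  by rewrite (le_trans (F_lipM x y))// ler_wpM2r ?enorm_ge0// ler_norm.
have sR0 : 0 < s%:R :> R by rewrite ltr0n.
have delta0 : 0 < deltaS.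
  by rewrite ltr_wpDl ?exprn_gt0// divr_ge0 ?sqr_ge0 ?ltW.
have bound x : ('E_P[(fun w => (enorm (g x w - grad F x) ^+ 2)%R)]
    <= (deltaS * (8 * L ^+ 2 * enorm x ^+ 2 + (2 * a ^+ 2 + L ^+ 2)))%:E)%E.
  apply: le_trans
    (expectation_sphere_estimator dF F_lip L0 d0 s0 h0 u_unif u_indep x) _.
  rewrite lee_fin /deltaS; set n := enorm x.
  set K := 8 * L ^+ 2 * n ^+ 2 + _; rewrite [leRHS]mulrDl.
  have n0 : 0 <= n := enorm_ge0 x.
  have Lh : L * h <= L by rewrite ler_piMr.
  (* The sampling term is matched with [d%:R ^+ 2 / s%:R] and the squared bias with [h ^+ 2], each
     against the same factor [K]. *)
  apply: lerD.
    rewrite exprMn mulrAC ler_wpM2l ?divr_ge0 ?sqr_ge0 ?(ltW sR0)//.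
    have le1 : 2 * enorm (grad F x) + L * h <= 2 * L * n + a.
      have := grad_growth hm (ltW hb) L0 F_diss F_lip x; rewrite -/n /a; lra.
    have : (2 * enorm (grad F x) + L * h) ^+ 2 <= (2 * L * n + a) ^+ 2.
      rewrite ler_pXn2r// nnegrE.
        by rewrite addr_ge0 ?mulr_ge0 ?enorm_ge0// ltW.
      by rewrite /a !addr_ge0 ?mulr_ge0// ltW.
    move=> /le_trans; apply.
    rewrite /K -subr_ge0.
    have -> : 8 * L ^+ 2 * n ^+ 2 + (2 * a ^+ 2 + L ^+ 2) - (2 * L * n + a) ^+ 2 =
      (2 * L * n - a) ^+ 2 + L ^+ 2 by ring.
    by rewrite addr_ge0 ?sqr_ge0.
  rewrite exprMn mulrC ler_wpM2l ?sqr_ge0// /K addrA lerDr.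
  by apply: addr_ge0; apply: mulr_ge0 => //; exact: sqr_ge0.
by split=> //; split.
Qed.
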